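(* Let $\Omega$ be the space of all simplicial subcomplexes of $\Delta_{\mathbb N}$, with the metric $d$ described below, and let $\mathcal R\subseteq\Omega$ be the set of complexes isomorphic to the Rado complex. Then $\mathcal R$ is residual in $\Omega$ (its complement is a countable union of nowhere dense sets), and therefore $\mathcal R$ is dense in $\Omega$.
   Context: $\Delta_{\mathbb N}$ is the simplicial complex with vertex set $\mathbb N=\{1,2,\dots\}$ whose simplexes are all finite nonempty subsets of $\mathbb N$; $\Delta_n\subseteq\Delta_{\mathbb N}$ is the full simplex on $\{1,\dots,n\}$. $\Omega$ is the set of all subcomplexes $X\subseteq\Delta_{\mathbb N}$. For $X\in\Omega$ put $X_n=X\cap\Delta_n$; for $X,Y\in\Omega$ let $h(X,Y)=\max\{n: X_n=Y_n\}$ (with $\Delta_0=\emptyset$, and $h=\infty$ if $X=Y$), and $d(X,Y)=\exp(-h(X,Y))$. This metric induces the inverse limit topology $\Omega=\varprojlim\Omega_n$, where $\Omega_n$ is the finite discrete set of subcomplexes of $\Delta_n$; $\Omega$ is compact. For $U\subseteq V(X)$, $X_U$ is the induced subcomplex; $\mathrm{Lk}_X(v)$ is the subcomplex of simplexes $\sigma$ with $v\notin\sigma$, $\sigma\cup\{v\}\in X$. The Rado complex is the unique (up to isomorphism) simplicial complex with a countable vertex set which is nonempty and satisfies: for every finite $U\subseteq V(X)$ and every subcomplex $A\subseteq X_U$ there exists $v\in V(X)\setminus U$ with $\mathrm{Lk}_X(v)\cap X_U=A$. *)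

(* Defs.v *)
From HB Require Import structures.
From mathcomp Require Import all_boot all_order all_algebra.
From mathcomp Require Import finmap.
From mathcomp Require Import all_classical all_reals all_analysis.

Set Implicit Arguments.
Unset Strict Implicit.
Unset Printing Implicit Defensive.

Import Order.TTheory GRing.Theory Num.Theory.

Local Open Scope classical_set_scope.
Local Open Scope ring_scope.

Section complexes.
Context {V : choiceType}.
Implicit Types (X A : set {fset V}) (U : set V) (s t : {fset V}) (v : V).

(* A complex is identified with its set of simplexes, which are nonempty; the
   complex with no simplex at all is allowed. *)
Definition is_complex X : Prop :=
  (forall s, X s -> s != fset0) /\
  (forall s t, X s -> (t `<=` s)%fset -> t != fset0 -> X t).

Definition subcomplex A X : Prop := is_complex A /\ A `<=` X.

Definition full_simplex U : set {fset V} :=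
  [set s | s != fset0 /\ [set` s] `<=` U].

Definition vertices X : set V := [set v | X [fset v]%fset].

Definition induced_subcomplex X U : set {fset V} := X `&` full_simplex U.

Definition link X v : set {fset V} :=
  [set s | [/\ X s, v \notin s & X (v |` s)%fset]].

Definition is_rado X : Prop :=
  [/\ is_complex X, countable (vertices X), X !=set0 &
    forall U A, finite_set U -> U `<=` vertices X ->
      subcomplex A (induced_subcomplex X U) ->
      exists v, [/\ vertices X v, ~ U v & link X v `&` induced_subcomplex X U = A]].

End complexes.

(* The ambient types are pointed so that a total function V -> W can represent
   a map of vertex sets even when these are empty. *)
Definition isomorphic (V W : pointedType)
    (X : set {fset V}) (Y : set {fset W}) : Prop :=
  exists f : V -> W, set_bij (vertices X) (vertices Y) f /\
    forall s : {fset V}, [set` s] `<=` vertices X ->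
      (X s <-> Y [fset f x | x in s]%fset).

(* "The" Rado complex: it has the defining property, and every complex with
   this property is isomorphic to it. *)
Definition is_the_rado_complex (V : pointedType) (Z : set {fset V}) : Prop :=
  is_rado Z /\
  forall (W : pointedType) (Y : set {fset W}), is_rado Y -> isomorphic Y Z.

Section category.
Context {T : topologicalType}.

Definition nowhere_dense (A : set T) : Prop := interior (closure A) = set0.

Definition residual (A : set T) : Prop :=
  exists F : nat -> set T,
    (forall n, nowhere_dense (F n)) /\ ~` A = \bigcup_n F n.

End category.

Definition DeltaN : set {fset nat} := full_simplex [set v : nat | (1 <= v)%N].

Definition Delta (n : nat) : set {fset nat} :=
  full_simplex [set v : nat | (1 <= v <= n)%N].

(* R plays no role in the carrier; it only fixes the field in which the
   distance takes its values. *)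
Record Omega (R : realType) := MkOmega {
  simplexes :> set {fset nat};
  simplexesP : subcomplex simplexes DeltaN }.

HB.instance Definition _ (R : realType) := gen_eqMixin (Omega R).
HB.instance Definition _ (R : realType) := gen_choiceMixin (Omega R).

Section metric.
Context {R : realType}.
Implicit Types X Y Z : Omega R.

Definition truncation X (n : nat) : set {fset nat} := X `&` Delta n.

(* The set of n is finite unless X = Y, in which case the value is +oo; see
   agreement_max and agreementxx below. *)
Definition agreement X Y : \bar R :=
  ereal_sup [set n%:R%:E | n in [set n | truncation X n = truncation Y n]].

Definition omega_dist X Y : R := fine (expeR (- agreement X Y)%E).

Lemma Omega_eq X Y : simplexes X = simplexes Y -> X = Y.
Proof.
case: X Y => X PX [Y PY] /= XY; rewrite XY in PX *.
by congr MkOmega; exact: Prop_irrelevance.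
Qed.

Lemma truncation_le X Y m n : (m <= n)%N ->
  truncation X n = truncation Y n -> truncation X m = truncation Y m.
Proof.
move=> mn XY.
have sub : Delta m `<=` Delta n.
  move=> s [s0 sm]; split => // v /sm /= /andP[-> vm].
  exact: leq_trans vm mn.
have E Z : truncation Z m = truncation Z n `&` Delta m.
  by rewrite /truncation -setIA (setIidr sub).
by rewrite !E XY.
Qed.

Lemma truncation_inj X Y :
  (forall n, truncation X n = truncation Y n) -> X = Y.
Proof.
move=> XY; apply: Omega_eq.
have key (A B : Omega R) : (forall n, truncation A n = truncation B n) ->
    simplexes A `<=` simplexes B.
  move=> AB s As; have [s0 s1] := (simplexesP A).2 _ As.
  suff : truncation B (\max_(v <- s) v) s by case.
  rewrite -AB; split => //; split => // v vs /=.
  by rewrite (s1 _ vs)/= (@leq_bigmax_seq _ _ _ (fun v => v)).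
by apply/seteqP; split; apply: key.
Qed.

Lemma le_agreement X Y n : truncation X n = truncation Y n ->
  (n%:R%:E <= agreement X Y)%E.
Proof. by move=> XY; apply: ereal_sup_ubound; exists n. Qed.

Lemma agreementxx X : agreement X X = +oo%E.
Proof.
apply: eq_infty => r.
apply: (@le_trans _ _ (Num.truncn `|r|).+1%:R%:E); last exact: le_agreement.
by rewrite lee_fin ltW// (le_lt_trans (ler_norm _))// truncnS_gt.
Qed.

Lemma agreement_le X Y n : truncation X n.+1 <> truncation Y n.+1 ->
  (agreement X Y <= n%:R%:E)%E.
Proof.
move=> XY; apply: ge_ereal_sup => _ [m /= mXY <-].
rewrite lee_fin ler_nat leqNgt; apply/negP => nm.
exact/XY/(truncation_le nm).
Qed.

Lemma agreement_max X Y : X <> Y ->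
  exists n : nat, [/\ agreement X Y = n%:R%:E,
    truncation X n = truncation Y n &
    forall m, truncation X m = truncation Y m -> (m <= n)%N].
Proof.
move=> XY.
have /existsNP ex : ~ forall n, truncation X n = truncation Y n.
  by move/truncation_inj.
have ex' : exists n, `[< truncation X n <> truncation Y n >].
  by case: ex => n /asboolP; exists n.
case: (ex_minnP ex') => -[|n] /asboolP nXY nmin.
  by exfalso; apply: nXY; apply/seteqP; split => s [_ [s0 /= s1]];
    case/fset0Pn: s0 => v /s1 /=; case: v.
have tn : truncation X n = truncation Y n.
  by apply: contrapT => /asboolP /nmin; rewrite ltnn.
exists n; split => //.
  by apply/eqP; rewrite eq_le agreement_le//= le_agreement.
move=> m mXY; rewrite leqNgt; apply/negP => nm.
exact/nXY/(truncation_le nm).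
Qed.

Lemma omega_distxx X : omega_dist X X = 0.
Proof. by rewrite /omega_dist agreementxx. Qed.

Lemma omega_distE X Y n : agreement X Y = n%:R%:E ->
  omega_dist X Y = expR (- n%:R).
Proof. by rewrite /omega_dist => ->. Qed.

Lemma omega_dist_ge0 X Y : 0 <= omega_dist X Y.
Proof. by rewrite /omega_dist fine_ge0// expeR_ge0. Qed.

Lemma omega_dist_positivity X Y : omega_dist X Y = 0 -> X = Y.
Proof.
move=> d0; apply: contrapT => /agreement_max[n [/omega_distE dn _ _]].
by have := expR_gt0 (- n%:R : R); rewrite -dn d0 ltxx.
Qed.

Lemma omega_dist_sym X Y : omega_dist X Y = omega_dist Y X.
Proof.
rewrite /omega_dist /agreement; congr (fine (expeR (- ereal_sup (_ @` _))%E)).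
by apply/seteqP; split => n /=.
Qed.

Lemma omega_dist_ge X Y n : truncation X n.+1 <> truncation Y n.+1 ->
  expR (- n%:R) <= omega_dist X Y.
Proof.
move=> nXY; have XY : X <> Y by move=> XY; apply: nXY; rewrite XY.
have [m [mE _ _]] := agreement_max XY; rewrite (omega_distE mE).
by rewrite ler_expR lerN2 -lee_fin -mE agreement_le.
Qed.

Lemma omega_dist_triangle Y X Z :
  omega_dist X Z <= omega_dist X Y + omega_dist Y Z.
Proof.
have [->|/agreement_max[n [/omega_distE -> _ nmax]]] := pselect (X = Z).
  by rewrite omega_distxx addr_ge0 ?omega_dist_ge0.
have [XY|XY] := pselect (truncation X n.+1 = truncation Y n.+1).
  have YZ : truncation Y n.+1 <> truncation Z n.+1.
    by move=> YZ; have := nmax n.+1; rewrite XY YZ ltnn => /(_ erefl).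
  by rewrite (le_trans (omega_dist_ge YZ))// lerDr omega_dist_ge0.
by rewrite (le_trans (omega_dist_ge XY))// lerDl omega_dist_ge0.
Qed.

End metric.

HB.instance Definition _ (R : realType) := @isMetric.Build R (Omega R)
  omega_dist omega_distxx omega_dist_positivity omega_dist_sym
  omega_dist_triangle.

Definition rado_class (R : realType) : set (Omega R) :=
  [set X | exists (V : pointedType) (Z : set {fset V}),
    is_the_rado_complex Z /\ isomorphic (simplexes X) Z].
Arguments rado_class : clear implicits.

(* Main.v *)
(**
  A complex in [Omega] fails to be Rado exactly when some extension problem
  [(U, A)], with [U] a finite set of vertices and [A] a subcomplex of [X_U], has
  no solution in it. There are countably many such problems. The complexes in
  which [(U, A)] is unsolved are nowhere dense: any complex can be truncated at
  an arbitrarily high level [n] and given a new vertex [n + 1] with link [A],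
  and every complex that agrees with the result up to [n + 1] solves [(U, A)].
  Density follows from Baire's theorem, [Omega] being complete as the inverse
  limit of the finite spaces of truncated complexes. Back-and-forth shows that
  all Rado complexes are isomorphic, so each of them is the Rado complex.
*)
Require Import Defs.
From HB Require Import structures.
From mathcomp Require Import all_boot all_order all_algebra.
From mathcomp Require Import finmap.
From mathcomp Require Import all_classical all_reals all_analysis.

Set Implicit Arguments.
Unset Strict Implicit.
Unset Printing Implicit Defensive.

Import Order.TTheory GRing.Theory Num.Theory.

Local Open Scope classical_set_scope.

Lemma indexed_dependent_choice (T : Type) (P : T -> Prop)
    (S : nat -> T -> T -> Prop) (x0 : T) :
  P x0 -> (forall n x, P x -> exists2 y, P y & S n x y) ->
  exists u : nat -> T,
    [/\ u 0 = x0, forall n, P (u n) & forall n, S n (u n) (u n.+1)].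
Proof.
move=> Px0 next.
have /choice[g gP] : forall nx : nat * T,
    exists y, P nx.2 -> P y /\ S nx.1 nx.2 y.
  move=> [n x]; have [Px|nPx] := pselect (P x); last by exists x.
  by have [y Py Sy] := next n x Px; exists y.
pose u := fix u n := if n is m.+1 then g (m, u m) else x0.
have Pu n : P (u n) by elim: n => //= n /(gP (n, _))[].
by exists u; split=> // n; have [] := gP (n, u n) (Pu n).
Qed.

Section baire_category.
Context {T : topologicalType}.
Implicit Types A B : set T.

Lemma nowhere_dense_dense_interiorC A : nowhere_dense A <-> dense (~` A)°.
Proof.
rewrite interiorC /nowhere_dense; split=> [A0 O On0 oO|dA].
  apply: contrapT => /set0P/negP; rewrite negbK => /eqP/subsets_disjoint.
  by rewrite open_subsetE// A0 subset0 => O0; case: On0; rewrite O0.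
apply/eqP/contraT => /set0P /(dA _)[|x [/interior_subset]//].
exact: open_interior.
Qed.

Lemma nowhere_denseS A B : A `<=` B -> nowhere_dense B -> nowhere_dense A.
Proof.
move=> AB; rewrite /nowhere_dense -!subset0; apply: subset_trans.
exact/interiorS/closureS.
Qed.

Lemma countable_cover_residual (I : countType) (F : I -> set T) A :
  (forall i, nowhere_dense (F i)) -> ~` A `<=` \bigcup_i F i -> residual A.
Proof.
move=> ndF AF.
exists (fun n => (if choice.unpickle n is Some i then F i else set0) `\` A).
split=> [n|].
  apply: nowhere_denseS (@subDsetl _ _ _) _.
  by case: choice.unpickle => //; rewrite /nowhere_dense closure0 interior0.
rewrite -setD_bigcupl; apply/seteqP; split=> [x nAx|x []//]; split=> //.
have [i _ Fix] := AF x nAx.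
by exists (choice.pickle i) => //; rewrite choice.pickleK.
Qed.

End baire_category.

Section baire.
Context {R : realType} {T : completePseudoMetricType R}.
Implicit Types (A O : set T) (x : T).

Local Open Scope ring_scope.

Lemma small_closed_ball_nbhs x O (d : {posnum R}) : nbhs x O ->
  exists2 e : {posnum R}, e%:num < d%:num & closed_ball x e%:num `<=` O.
Proof.
move=> /nbhs_ballP[_/posnumP[r] rO].
have m_gt0 : 0 < Num.min d%:num r%:num / 2 by [].
exists (PosNum m_gt0) => /=.
  rewrite ltr_pdivrMr// (le_lt_trans (_ : _ <= d%:num)) ?ge_min ?lexx//.
  by rewrite ltr_pMr// ltr1n.
apply: subset_trans (subset_closure_half _) _ => //.
by apply: subset_trans rO; apply: le_ball; rewrite ge_min lexx orbT.
Qed.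

Lemma nested_closed_balls_nonempty (x : nat -> T) (r : nat -> {posnum R}) :
  (forall n, closed_ball (x n.+1) (r n.+1)%:num `<=` ball (x n) (r n)%:num) ->
  (forall n, (r n.+1)%:num < n.+1%:R^-1) ->
  \bigcap_n closed_ball (x n) (r n)%:num !=set0.
Proof.
move=> nested r_small; pose B n := closed_ball (x n) (r n)%:num.
have decrB m n : (m <= n)%N -> B n `<=` B m.
  apply: (homo_leq (r := fun A C => C `<=` A)) => [A //|C A E CA EC|k].
    exact: subset_trans EC CA.
  by apply: subset_trans (nested k) _; exact: subset_closure.
have xB n : B n (x n) by exact: closed_ballxx.
have /cauchy_cvg/cvg_ex[/= l xl] : cauchy (x @ \oo).
  apply: cauchy_exP => e e0; pose n := Num.truncn e^-1.
  exists (x n.+1), n.+2 => // m /= nm.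
  apply: le_ball (nested _ _ (decrB _ _ nm _ (xB m))).
  apply/ltW/(lt_le_trans (r_small n)).
  by rewrite invf_ple ?posrE// ltW// truncnS_gt.
exists l => n _; apply: (closed_cvg (B n) _ _ _ xl).
  exact: closed_ball_closed.
by exists n => // m nm; exact: decrB (xB m).
Qed.

Theorem complete_dense_bigcap (D : nat -> set T) :
  (forall n, open (D n)) -> (forall n, dense (D n)) -> dense (\bigcap_n D n).
Proof.
move=> oD dD O [x0 Ox0] oO.
have [e0 _ e0O] := small_closed_ball_nbhs 1%:pos (open_nbhs_nbhs (conj oO Ox0)).
have [||u [u0 _ uS]] := @indexed_dependent_choice (T * {posnum R})%type
    (fun=> True) (fun n p q =>
      closed_ball q.1 q.2%:num `<=` ball p.1 p.2%:num `&` D n /\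
      q.2%:num < n.+1%:R^-1) (x0, e0) => //.
  move=> n [x e] _; have [|y] := dD n (ball x e%:num)° _ (@open_interior _ _).
    by exists x; exact: nbhsx_ballx.
  move=> [xey Dny].
  have n_gt0 : 0 < n.+1%:R^-1 :> R by [].
  have /(small_closed_ball_nbhs (PosNum n_gt0))[d dn dy] :
      nbhs y (ball x e%:num `&` D n).
    by apply: filterI xey _; exact: open_nbhs_nbhs.
  by exists (y, d).
have [|n|l Bl] :=
    @nested_closed_balls_nonempty (fun n => (u n).1) (fun n => (u n).2).
- by move=> n y /(uS n).1[].
- by have [] := uS n.
exists l; split; first by apply: e0O; have := Bl 0%N I; rewrite u0.
by move=> n _; have [] := (uS n).1 _ (Bl n.+1 I).
Qed.

Corollary residual_dense A : residual A -> dense A.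
Proof.
move=> [F [ndF AF]].
have /complete_dense_bigcap dF n : open (~` F n)° by exact: open_interior.
have {}dF : dense (\bigcap_n (~` F n)°).
  by apply: dF => n; exact/nowhere_dense_dense_interiorC.
move=> O On0 oO; have [x [Ox Fx]] := dF O On0 oO; exists x; split=> //.
apply: contrapT => nAx; have : (~` A) x by [].
by rewrite AF => -[n _ Fnx]; have /interior_subset := Fx n I.
Qed.

End baire.

Section complexes.
Context {V : choiceType}.
Implicit Types (X A : set {fset V}) (U : set V) (s : {fset V}) (v w : V).

Lemma subcomplex_set0 X : subcomplex set0 X.
Proof. by split. Qed.

Lemma is_complex_full_simplex U : is_complex (full_simplex U).
Proof.
split=> [s []//|s t [_ sU] ts t0]; split=> // v vt.
exact/sU/(fsubsetP ts).
Qed.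

Lemma is_complexI X A : is_complex X -> is_complex A -> is_complex (X `&` A).
Proof.
move=> [X0 Xdown] [_ Adown]; split=> [s [/X0]//|s t [Xs As] ts t0].
by split; [exact: Xdown Xs ts t0|exact: Adown As ts t0].
Qed.

Lemma is_complex_bigcup (I : Type) (F : I -> set {fset V}) :
  (forall i, is_complex (F i)) -> is_complex (\bigcup_i F i).
Proof.
move=> cF; split=> [s [i _]|s t [i _ Fs] ts t0]; first exact: (cF i).1.
by exists i => //; exact: (cF i).2 Fs ts t0.
Qed.

Lemma simplex_vertices X s v :
  is_complex X -> X s -> v \in s -> vertices X v.
Proof.
move=> [_ Xdown] Xs vs; apply: Xdown Xs _ _; first by rewrite fsub1set.
by apply/fset0Pn; exists v; rewrite inE.
Qed.

Lemma vertices_nonempty X : is_complex X -> X !=set0 -> vertices X !=set0.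
Proof.
move=> cX [s Xs]; have /fset0Pn[v vs] := cX.1 _ Xs.
by exists v; exact: simplex_vertices Xs vs.
Qed.

Lemma finite_full_simplex U : finite_set U -> finite_set (full_simplex U).
Proof.
move=> finU; apply: sub_finite_set (finite_fset (fpowerset (fset_set U))).
move=> s [_ sU]; rewrite /= fpowersetE; apply/fsubsetP => v /sU Uv.
by rewrite in_fset_set// inE.
Qed.

End complexes.

Lemma imfset_eq0 (K T : choiceType) (h : K -> T) (t : {fset K}) :
  ((h @` t)%fset == fset0) = (t == fset0).
Proof.
apply/idP/idP=> [|/eqP ->]; last by rewrite imfset0.
apply: contraLR => /fset0Pn[i it]; apply/fset0Pn; exists (h i).
exact: in_imfset.
Qed.

Lemma fset_sub_bigcup_nondecreasing (T : choiceType) (u : nat -> set T)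
    (t : {fset T}) :
  {homo u : m n / (m <= n)%N >-> m `<=` n} ->
  [set` t] `<=` \bigcup_n u n -> exists n, [set` t] `<=` u n.
Proof.
move=> homo_u tu.
have /choice[level tlevel] : forall x, exists n, x \in t -> u n x.
  move=> x; have [/tu[n _ unx]|_] := boolP (x \in t); first by exists n.
  by exists 0.
exists (\max_(x <- t) level x) => x xt.
by apply: homo_u (tlevel x xt); exact: leq_bigmax_seq.
Qed.

Lemma countable_eq_range (T : Type) (A : set T) :
  countable A -> A !=set0 -> exists e : nat -> T, range e = A.
Proof.
move=> /pfcard_geP[->[]//|[e] _]; exists e.
by apply/seteqP; split=> [_ [n _ <-]|x /(@surj _ _ _ _ e)//]; exact: funS.
Qed.

Section partial_isomorphisms.
Context {I V W : choiceType}.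
Implicit Types (P Q : set I) (t : {fset I}) (i j : I).

(* A set [P] of indices stands for the relation [f i ~ g i], [i] in [P]. Leaving
   the projections [f] and [g] abstract makes the notion symmetric under their
   exchange. *)
Definition partial_iso (f : I -> V) (g : I -> W)
    (X : set {fset V}) (Y : set {fset W}) P : Prop :=
  [/\ forall i, P i -> vertices X (f i) /\ vertices Y (g i),
      forall i j, P i -> P j -> f i = f j <-> g i = g j &
      forall t, [set` t] `<=` P -> X (f @` t)%fset <-> Y (g @` t)%fset].

Lemma partial_iso0 (f : I -> V) (g : I -> W) X Y :
  is_complex X -> is_complex Y -> partial_iso f g X Y set0.
Proof.
move=> [X0 _] [Y0 _]; split=> // t.
rewrite subset0 => /eqP; rewrite set_fset_eq0 => /eqP ->.
by rewrite !imfset0; split=> [/X0|/Y0]; rewrite eqxx.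
Qed.

Lemma partial_iso_bigcup (f : I -> V) (g : I -> W) X Y (u : nat -> set I) :
  {homo u : m n / (m <= n)%N >-> m `<=` n} ->
  (forall n, partial_iso f g X Y (u n)) ->
  partial_iso f g X Y (\bigcup_n u n).
Proof.
move=> homo_u iso_u; split=> [i [n _]|i j ui uj|t].
- by have [+ _ _] := iso_u n; exact.
- have [|n un] := @fset_sub_bigcup_nondecreasing _ _ [fset i; j]%fset homo_u.
    by move=> k; rewrite /= !inE => /orP[] /eqP ->.
  have [_ + _] := iso_u n; apply; apply: un; rewrite /= !inE eqxx ?orbT//.
- move=> /(fset_sub_bigcup_nondecreasing homo_u)[n].
  by have [_ _] := iso_u n; exact.
Qed.

Section fixed_projections.
Variables (f : I -> V) (g : I -> W) (X : set {fset V}) (Y : set {fset W}).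

Lemma partial_iso_imfset_eq P t t' : partial_iso f g X Y P ->
  [set` t] `<=` P -> [set` t'] `<=` P ->
  (g @` t = g @` t')%fset -> (f @` t = f @` t')%fset.
Proof.
move=> [_ fgP _].
have sub (t1 t2 : {fset I}) : [set` t1] `<=` P -> [set` t2] `<=` P ->
    (g @` t1 = g @` t2)%fset -> (f @` t1 `<=` f @` t2)%fset.
  move=> t1P t2P gt; apply/fsubsetP => _ /imfsetP[i /= it1 ->].
  have : g i \in (g @` t2)%fset by rewrite -gt; exact: in_imfset.
  case/imfsetP => j /= jt2 /(fgP _ _ (t1P _ it1) (t2P _ jt2)) ->.
  exact: in_imfset.
by move=> tP t'P gt; apply/eqP; rewrite eqEfsubset !sub.
Qed.

(* The complex that a new vertex of [Y] must have as its link in order to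
   correspond to the vertex [v] of [X]. *)
Definition transported_link P (v : V) : set {fset W} :=
  [set r | exists2 t : {fset I},
    [/\ [set` t] `<=` P, t != fset0 & X (v |` f @` t)%fset] &
    (g @` t)%fset = r].

Lemma transported_linkE P v t : partial_iso f g X Y P ->
  [set` t] `<=` P -> t != fset0 ->
  transported_link P v (g @` t)%fset <-> X (v |` f @` t)%fset.
Proof.
move=> isoP tP t0; split=> [[t' [t'P _ Xt'] gt]|Xt]; last by exists t.
by rewrite -(partial_iso_imfset_eq isoP t'P tP gt).
Qed.

Lemma subcomplex_transported_link P v : is_complex X ->
  partial_iso f g X Y P ->
  subcomplex (transported_link P v) (induced_subcomplex Y (g @` P)).
Proof.
move=> [_ Xdown] [_ _ XY]; split; first split.
- by move=> _ [t [_ t0 _] <-]; rewrite imfset_eq0.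
- move=> _ r [t [tP t0 Xt] <-] /fsubsetP rt r0.
  pose t' := [fset i in t | g i \in r]%fset.
  have gt' : (g @` t')%fset = r.
    apply/fsetP => w; apply/imfsetP/idP => [[i /= +->]|wr].
      by rewrite !inE => /andP[].
    have /imfsetP[i /= it wE] := rt _ wr.
    by exists i => //=; rewrite !inE it -wE.
  have t't : (t' `<=` t)%fset by exact: fset_sub.
  exists t' => //; split=> [i /(fsubsetP t't)/tP//||].
    by rewrite -(imfset_eq0 g) gt'.
  apply: Xdown Xt _ _; last by apply/fset0Pn; exists v; rewrite fset1U1.
  exact/fsetUS/subset_imfset/fsubsetP.
- move=> _ [t [tP t0 Xt] <-]; split; last first.
    split; first by rewrite imfset_eq0.
    by rewrite set_imfset; exact: image_subset.
  apply/XY => //; apply: Xdown Xt _ _; first exact: fsubsetUr.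
  by rewrite imfset_eq0.
Qed.

Lemma partial_isoU1 P i : partial_iso f g X Y P ->
  vertices X (f i) -> vertices Y (g i) ->
  ~ (f @` P) (f i) -> ~ (g @` P) (g i) ->
  (forall t, [set` t] `<=` P -> t != fset0 ->
     X (f i |` f @` t)%fset <-> Y (g i |` g @` t)%fset) ->
  partial_iso f g X Y (i |` P).
Proof.
move=> [vP fgP XY] Xfi Ygi fiNP giNP XYi.
have fN j : P j -> f i <> f j by move=> Pj fij; apply: fiNP; exists j.
have gN j : P j -> g i <> g j by move=> Pj gij; apply: giNP; exists j.
split=> [j [->//|/vP//]|j k [->|Pj] [->|Pk] //|t tP].
- by split=> [/fN|/gN] /(_ Pk).
- by split=> /esym => [/fN|/gN] /(_ Pj).
- exact: fgP.
have [it|itN] := boolP (i \in t); last first.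
  by apply: XY => j jt; case: (tP j jt) => // ji; rewrite -ji jt in itN.
rewrite -(fsetD1K it) !imfsetU1.
have [->|tD0] := eqVneq (t `\ i)%fset fset0; first by rewrite !imfset0 !fsetU0.
apply: XYi => // j; rewrite /= !inE => /andP[/eqP ji jt].
by case: (tP j jt).
Qed.

Lemma partial_iso_extend P v :
  (forall v' w, exists2 i, f i = v' & g i = w) ->
  is_complex X -> is_rado Y -> finite_set P -> partial_iso f g X Y P ->
  vertices X v ->
  exists Q, [/\ finite_set Q, partial_iso f g X Y Q, P `<=` Q & (f @` Q) v].
Proof.
move=> pairing cX [cY _ _ Yext] finP isoP Xv.
have [vP|vNP] := pselect ((f @` P) v); first by exists P; split.
have gPY : g @` P `<=` vertices Y.
  by move=> _ [i Pi <-]; have [+ _ _] := isoP => /(_ i Pi)[].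
have [w [Yw wNP wlink]] := Yext _ _ (finite_image g finP) gPY
  (subcomplex_transported_link v cX isoP).
have [i fi gi] := pairing v w.
exists (i |` P); split; last 2 first.
- exact: subsetUr.
- by exists i => //; left.
- by rewrite finite_setU; split=> //; exact: finite_set1.
apply: partial_isoU1 => //; rewrite ?fi ?gi// => t tP t0.
rewrite -(transported_linkE v isoP tP t0) -wlink.
have gt0 : (g @` t)%fset != fset0 by rewrite imfset_eq0.
have gtP : [set` (g @` t)%fset] `<=` g @` P.
  by rewrite set_imfset; exact: image_subset.
split=> [[[]]//|Ywt].
have Yt : Y (g @` t)%fset by apply: cY.2 Ywt _ gt0; exact: fsubsetUr.
by split=> //; split=> //; apply/negP => /gtP.
Qed.

End fixed_projections.

End partial_isomorphisms.

Lemma partial_isoC (I V W : choiceType) (f : I -> V) (g : I -> W) X Y P :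
  partial_iso f g X Y P -> partial_iso g f Y X P.
Proof.
case=> vP fgP XY; split=> [i /vP[]|i j Pi Pj|t /XY ->] //.
by rewrite fgP.
Qed.

Lemma total_partial_iso_isomorphic (I V W : pointedType) (f : I -> V)
    (g : I -> W) (X : set {fset V}) (Y : set {fset W}) (P : set I) :
  partial_iso f g X Y P -> vertices X `<=` f @` P -> vertices Y `<=` g @` P ->
  isomorphic X Y.
Proof.
move=> [vP fgP XY] fP gP.
have /choice[s sP] : forall v, exists i, vertices X v -> P i /\ f i = v.
  move=> v; have [/fP[i Pi <-]|nXv] := pselect (vertices X v).
    by exists i.
  by exists point.
exists (g \o s); split; first split.
- by move=> v /sP[/vP[]].
- move=> v v' /set_mem/sP[Pv fv] /set_mem/sP[Pv' fv'] /(fgP _ _ Pv Pv').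
  by rewrite fv fv'.
- move=> _ /gP[i Pi <-]; have [Xfi _] := vP _ Pi; exists (f i) => //=.
  by have [Psi fsi] := sP _ Xfi; exact/fgP.
move=> r rX; have fsr : (f @` (s @` r))%fset = r.
  rewrite -imfset_comp -[RHS]imfset_id.
  by apply: eq_in_imfset => v /rX/sP[].
rewrite -{1}fsr (imfset_comp _ s g); apply: XY.
by move=> _ /imfsetP[v /= /rX/sP[Psv _] ->].
Qed.

Lemma rado_vertices_range (V : choiceType) (X : set {fset V}) :
  is_rado X -> exists e : nat -> V, range e = vertices X.
Proof.
move=> [cX countX X0 _]; apply: countable_eq_range => //.
exact: vertices_nonempty.
Qed.

Lemma back_and_forth (V W : choiceType) (X : set {fset V}) (Y : set {fset W})
    (P : set (V * W)) v w :
  is_rado X -> is_rado Y -> finite_set P -> partial_iso fst snd X Y P ->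
  vertices X v -> vertices Y w ->
  exists Q, [/\ finite_set Q, partial_iso fst snd X Y Q, P `<=` Q,
    (fst @` Q) v & (snd @` Q) w].
Proof.
move=> radoX radoY finP isoP Xv Yw.
have [cX _ _ _] := radoX; have [cY _ _ _] := radoY.
have [|Q [finQ isoQ PQ Qv]] := partial_iso_extend _ cX radoY finP isoP Xv.
  by move=> v' w'; exists (v', w').
have [|S [finS /partial_isoC isoS QS Sw]] :=
    partial_iso_extend _ cY radoX finQ (partial_isoC isoQ) Yw.
  by move=> w' v'; exists (v', w').
exists S; split=> //; first exact: subset_trans QS.
exact: image_subset Qv.
Qed.

Theorem rado_isomorphic (V W : pointedType)
    (X : set {fset V}) (Y : set {fset W}) :
  is_rado X -> is_rado Y -> isomorphic X Y.
Proof.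
move=> radoX radoY; have [cX _ _ _] := radoX; have [cY _ _ _] := radoY.
have [eX eXE] := rado_vertices_range radoX.
have [eY eYE] := rado_vertices_range radoY.
have [||u [_ finiso_u uS]] := @indexed_dependent_choice (set (V * W))
    (fun P => finite_set P /\ partial_iso fst snd X Y P)
    (fun n P Q => [/\ P `<=` Q, (fst @` Q) (eX n) & (snd @` Q) (eY n)]) set0.
- by split; [exact: finite_set0|exact: partial_iso0].
- move=> n P [finP isoP].
  have [||Q [finQ isoQ PQ QX QY]] :=
      @back_and_forth _ _ _ _ P (eX n) (eY n) radoX radoY finP isoP.
  + by rewrite -eXE; exists n.
  + by rewrite -eYE; exists n.
  + by exists Q.
apply: (@total_partial_iso_isomorphic _ _ _ fst snd _ _ (\bigcup_n u n)).
- apply: partial_iso_bigcup => [|n]; last by have [] := finiso_u n.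
  apply: homo_leq => [A //|B A C AB BC|n]; first exact: subset_trans BC.
  by have [] := uS n.
- rewrite -eXE => _ [n _ <-]; have [_ [i ui iX] _] := uS n.
  by exists i => //; exists n.+1.
- rewrite -eYE => _ [n _ <-]; have [_ _ [i ui iY]] := uS n.
  by exists i => //; exists n.+1.
Qed.

Corollary rado_the_rado (V : pointedType) (X : set {fset V}) :
  is_rado X -> is_the_rado_complex X.
Proof. by move=> radoX; split=> // W Y radoY; exact: rado_isomorphic. Qed.

HB.instance Definition _ (R : realType) :=
  isPointed.Build (Omega R) (MkOmega R (subcomplex_set0 DeltaN)).

Section omega_topology.
Context {R : realType}.
Implicit Types (X Y Z : Omega R) (F : set (Omega R)) (s : {fset nat}).

Definition cylinder X n : set (Omega R) :=
  [set Y | truncation X n = truncation Y n].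

Lemma cylinderS X m n : (m <= n)%N -> cylinder X n `<=` cylinder X m.
Proof. by move=> mn Y; exact: truncation_le. Qed.

Lemma omega_dist_le X Y n :
  cylinder X n Y -> (omega_dist X Y <= expR (- n%:R))%R.
Proof.
move=> XY.
have [->|/agreement_max[m [/omega_distE -> _ mmax]]] := pselect (X = Y).
  by rewrite omega_distxx expR_ge0.
by rewrite ler_expR lerN2 ler_nat mmax.
Qed.

Lemma ball_sub_cylinder X n : ball X (expR (- n%:R))%R `<=` cylinder X n.
Proof.
move=> Y /= XY; apply: contrapT => nXY.
have /omega_dist_ge : truncation X n.+1 <> truncation Y n.+1.
  by move/(truncation_le (leqnSn n)).
by rewrite leNgt XY.
Qed.

Lemma nbhs_cylinderP X F : nbhs X F <-> exists n, cylinder X n `<=` F.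
Proof.
split=> [/nbhs_ballP[e /= e0 eF]|[n nF]].
  exists (Num.truncn e^-1)%R.+1 => Y /omega_dist_le XY; apply: eF.
  apply: (le_lt_trans XY); rewrite expRN invf_plt ?posrE ?expR_gt0//.
  rewrite (lt_le_trans (truncnS_gt _))//.
  by rewrite (le_trans _ (expR_ge1Dx _))// lerDr.
apply/nbhs_ballP; exists (expR (- n%:R))%R; first exact: expR_gt0.
exact: subset_trans (@ball_sub_cylinder X n) nF.
Qed.

Lemma truncationP X n s :
  truncation X n s <-> simplexes X s /\ {in s, forall v, (v <= n)%N}.
Proof.
split=> [[Xs [_ sn]]|[Xs sn]]; split=> //; first by move=> v /sn/andP[].
have [s0 sN] := (simplexesP X).2 _ Xs; split=> // v vs /=.
by rewrite (sn v vs) andbT; exact: sN.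
Qed.

Lemma is_complex_truncation X n : is_complex (truncation X n).
Proof.
by apply: is_complexI; [exact: (simplexesP X).1|exact: is_complex_full_simplex].
Qed.

Lemma subcomplex_truncation X n : subcomplex (truncation X n) DeltaN.
Proof.
split; first exact: is_complex_truncation.
by move=> s [/((simplexesP X).2)].
Qed.

Definition omega_truncation X n : Omega R :=
  MkOmega R (subcomplex_truncation X n).

Lemma cylinder_omega_truncation X n : cylinder X n (omega_truncation X n).
Proof. by rewrite /cylinder /= /truncation /= -setIA setIid. Qed.

(* [Omega] is the inverse limit of its finite truncations. *)
Lemma cylinder_bigcap_nonempty (u : nat -> Omega R) :
  (forall m n, (m <= n)%N -> cylinder (u m) m (u n)) ->
  \bigcap_n cylinder (u n) n !=set0.
Proof.
move=> coherent; pose L := \bigcup_n truncation (u n) n.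
have LP : subcomplex L DeltaN.
  split; first by apply: is_complex_bigcup => n; exact: is_complex_truncation.
  by move=> s [n _ /(subcomplex_truncation _ _).2].
exists (MkOmega R LP) => n _; apply/seteqP; split=> [s us|s [[m _ us] sn]].
  by split; [exists n|case: us].
have [nm|/ltnW mn] := leqP n m.
  by rewrite (coherent _ _ nm); split=> //; case: us.
by split=> //; move: us; rewrite (coherent _ _ mn) => -[].
Qed.

Lemma omega_cauchy_cvg (F : set_system (Omega R)) :
  ProperFilter F -> cauchy F -> cvg F.
Proof.
move=> FF cauchyF.
have /choice[u Fu] n : exists X, F (cylinder X n).
  have [X FX] := (cauchyP F).1 cauchyF _ (expR_gt0 (- n%:R)%R).
  by exists X; apply: filterS FX; exact: ball_sub_cylinder.
have [m n mn|Z uZ] := @cylinder_bigcap_nonempty u.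
  have [X [mX nX]] := filter_ex (filterI (Fu m) (Fu n)).
  by rewrite /cylinder /= mX; apply/esym/(truncation_le mn).
apply/cvg_ex; exists Z => A /nbhs_cylinderP[n nA].
apply: filterS (Fu n) => X uX; apply: nA.
by rewrite /cylinder /= -(uZ n I).
Qed.

End omega_topology.

HB.instance Definition _ (R : realType) :=
  Uniform_isComplete.Build (Omega R) (@omega_cauchy_cvg R).

Section add_vertex.
Context {V : choiceType}.
Implicit Types (X A : set {fset V}) (U S : set V) (s : {fset V}) (v w : V).

(* [fset0] yields the simplex formed by [w] alone, as links contain nonempty
   simplexes only. *)
Definition add_vertex X w A : set {fset V} :=
  X `|` [set (w |` s)%fset | s in fset0 |` A].

Lemma add_vertex_notin X w A s : w \notin s -> add_vertex X w A s <-> X s.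
Proof.
move=> ws; split=> [[//|[r _ rs]]|Xs]; last by left.
by rewrite -rs fset1U1 in ws.
Qed.

Lemma add_vertex_fsetU1 X w A s :
  is_complex X -> A `<=` X -> ~ vertices X w -> w \notin s ->
  add_vertex X w A (w |` s)%fset <-> (fset0 |` A) s.
Proof.
move=> cX AX Xw ws; split=> [[Xws|[r r0A rs]]|s0A]; last by right; exists s.
  by exfalso; apply: Xw; apply: simplex_vertices cX Xws _; rewrite fset1U1.
have wr : w \notin r.
  case: r0A => [->//|/AX Xr]; apply/negP => wr.
  exact/Xw/(simplex_vertices cX Xr).
by rewrite -(fsetU1K ws) -rs fsetU1K.
Qed.

Lemma is_complex_add_vertex X w A :
  is_complex X -> subcomplex A X -> is_complex (add_vertex X w A).
Proof.
move=> [X0 Xdown] [[_ Adown] AX]; split=> [s [/X0//|[r _ <-]]|s t].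
  by apply/fset0Pn; exists w; rewrite fset1U1.
move=> [Xs|[r r0A <-]] ts t0; first by left; exact: Xdown Xs ts t0.
have trw : (t `\ w `<=` r)%fset by rewrite fsubDset.
have [wt|wt] := boolP (w \in t).
  right; exists (t `\ w)%fset; last exact: fsetD1K.
  have [tw0|tw0] := eqVneq (t `\ w)%fset fset0; [by left|right].
  case: r0A trw => [->|Ar trw]; last exact: Adown Ar trw tw0.
  by rewrite fsubset0 (negbTE tw0).
have tw : (t `\ w)%fset = t by apply/mem_fsetD1.
rewrite tw in trw; left; case: r0A trw => [->|Ar trw].
  by rewrite fsubset0 (negbTE t0).
exact/AX/(Adown _ _ Ar trw t0).
Qed.

Lemma add_vertex_full_simplex X w A S :
  X `<=` full_simplex S -> A `<=` full_simplex S -> S w ->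
  add_vertex X w A `<=` full_simplex S.
Proof.
move=> XS AS Sw _ [/XS//|[r r0A <-]]; split.
  by apply/fset0Pn; exists w; rewrite fset1U1.
move=> v; rewrite /= !inE => /orP[/eqP ->//|].
by case: r0A => [->|/AS[_]]; [rewrite inE|exact].
Qed.

Lemma link_add_vertex X w A :
  is_complex X -> subcomplex A X -> ~ vertices X w ->
  link (add_vertex X w A) w = A.
Proof.
move=> cX [cA AX] Xw; apply/seteqP; split=> [s [+ ws]|s As].
  rewrite (add_vertex_notin _ _ ws) (add_vertex_fsetU1 cX AX Xw ws).
  by move=> /cX.1 s0 [sE|//]; rewrite sE eqxx in s0.
have ws : w \notin s.
  by apply/negP => /(simplex_vertices cX (AX _ As)).
split=> //; first by apply/add_vertex_notin => //; exact: AX.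
by apply/add_vertex_fsetU1 => //; right.
Qed.

Definition realizes_link X U A v : Prop :=
  [/\ vertices X v, ~ U v & link X v `&` induced_subcomplex X U = A].

Lemma add_vertex_realizes_link X U A w :
  is_complex X -> U `<=` vertices X -> subcomplex A (induced_subcomplex X U) ->
  ~ vertices X w -> realizes_link (add_vertex X w A) U A w.
Proof.
move=> cX UX [cA AXU] Xw.
have AX : subcomplex A X by split=> // s /AXU[].
split; last 1 first.
- rewrite link_add_vertex//; apply/setIidPl => s /AXU[Xs sU].
  by split=> //; left.
- by right; exists fset0; [left|rewrite fsetU0].
- by move=> /UX.
Qed.

End add_vertex.

Section cylinder_invariance.
Context {R : realType} (X Y : Omega R) (n : nat).
Hypothesis XY : cylinder X n Y.
Implicit Types (s : {fset nat}) (U : set nat) (A : set {fset nat}) (v : nat).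

Lemma simplexes_cylinder s : {in s, forall v, (v <= n)%N} ->
  simplexes X s = simplexes Y s.
Proof.
move=> sn; have truncE Z : simplexes Z s = truncation Z n s.
  by apply/propext; split=> [Zs|/truncationP[]//]; exact/truncationP.
by rewrite !truncE XY.
Qed.

Lemma vertices_cylinder v : (v <= n)%N -> vertices X v = vertices Y v.
Proof. by move=> vn; apply: simplexes_cylinder => x /fset1P ->. Qed.

Lemma link_cylinder v s : (v <= n)%N -> {in s, forall x, (x <= n)%N} ->
  link X v s = link Y v s.
Proof.
move=> vn sn; rewrite /link /= !simplexes_cylinder// => x.
by rewrite !inE => /orP[/eqP ->|/sn].
Qed.

Lemma induced_subcomplex_cylinder U : (forall v, U v -> (v <= n)%N) ->
  induced_subcomplex X U = induced_subcomplex Y U.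
Proof.
by move=> Un; apply/seteqP; split=> s [Xs [s0 sU]]; split=> //;
  [rewrite -simplexes_cylinder|rewrite simplexes_cylinder] => // v /sU/Un.
Qed.

Lemma realizes_link_cylinder U A v :
  (v <= n)%N -> (forall x, U x -> (x <= n)%N) ->
  realizes_link X U A v -> realizes_link Y U A v.
Proof.
move=> vn Un [Xv Uv <-]; split=> //; first by rewrite -vertices_cylinder.
rewrite -induced_subcomplex_cylinder//; apply/seteqP.
by split=> s [Ls [Xs [s0 sU]]]; split=> //;
  [rewrite link_cylinder|rewrite -link_cylinder] => // x /sU/Un.
Qed.

End cylinder_invariance.

Section extension_problems.
Context {R : realType}.
Implicit Types X Y Z : Omega R.

Lemma cylinder_realizes_link X n (U : set nat) (A : set {fset nat}) :
  U `<=` vertices X -> (forall v, U v -> (v <= n)%N) ->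
  subcomplex A (induced_subcomplex X U) ->
  exists2 Y, cylinder X n Y & realizes_link Y U A n.+1.
Proof.
move=> UX Un AXU; pose Z := omega_truncation X n.
have XZ : cylinder X n Z by exact: cylinder_omega_truncation.
have cZ : is_complex Z by exact: is_complex_truncation.
have UZ : U `<=` vertices Z.
  by move=> v Uv; rewrite -(vertices_cylinder XZ (Un v Uv)); exact: UX.
have AZU : subcomplex A (induced_subcomplex Z U).
  by rewrite -(induced_subcomplex_cylinder XZ).
have Zn1 : ~ vertices Z n.+1.
  by move=> /truncationP[_ /(_ _ (fset11 _))]; rewrite ltnn.
have AZ : A `<=` Z by move=> s /AZU.2[].
have LP : subcomplex (add_vertex Z n.+1 A) DeltaN.
  have [_ ZN] := simplexesP Z; split.
    by apply: is_complex_add_vertex => //; split=> //; case: AZU.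
  by apply: add_vertex_full_simplex => //; exact: subset_trans ZN.
exists (MkOmega R LP); last exact: add_vertex_realizes_link.
have ZY : cylinder Z n (MkOmega R LP).
  apply/seteqP; split=> s /truncationP[Zs sn]; apply/truncationP; split=> //.
    by left.
  have n1s : n.+1 \notin s by apply/negP => /sn; rewrite ltnn.
  exact/(add_vertex_notin Z A n1s).
exact: etrans XZ ZY.
Qed.

Definition unsolved (U : {fset nat}) (A : {fset {fset nat}}) : set (Omega R) :=
  [set X | [/\ [set` U] `<=` vertices X,
    subcomplex [set` A] (induced_subcomplex X [set` U]) &
    ~ exists v, realizes_link X [set` U] [set` A] v]].

Lemma not_rado_unsolved X :
  ~ is_rado (simplexes X) -> exists U A, unsolved U A X.
Proof.
move=> nR; apply: contrapT => solved; apply: nR.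
have ext (U : set nat) (A : set {fset nat}) :
    finite_set U -> U `<=` vertices X ->
    subcomplex A (induced_subcomplex X U) -> exists v, realizes_link X U A v.
  move=> finU UX AX; apply: contrapT => no; apply: solved.
  have finA : finite_set A.
    by apply: sub_finite_set (finite_full_simplex finU) => s /AX.2[].
  by exists (fset_set U), (fset_set A); rewrite /unsolved /= !fset_setK.
split=> //; [exact: (simplexesP X).1|exact: countableP|].
have [|//||v [Xv _ _]] := ext set0 set0.
- exact: finite_set0.
- exact: subcomplex_set0.
by exists [fset v]%fset.
Qed.

Lemma unsolved_nowhere_dense U A : nowhere_dense (unsolved U A).
Proof.
apply/nowhere_dense_dense_interiorC => O [X OX] oO.
have /nbhs_cylinderP[m mO] : nbhs X O by exact: open_nbhs_nbhs.
pose n := maxn m (\max_(v <- U) v).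
have nO : cylinder X n `<=` O.
  by apply: subset_trans mO; apply: cylinderS; exact: leq_maxl.
have Un v : [set` U] v -> (v <= n)%N.
  by move=> vU; rewrite leq_max (@leq_bigmax_seq _ _ _ id) ?orbT.
have [[UX AX]|noproblem] := pselect ([set` U] `<=` vertices X /\
    subcomplex [set` A] (induced_subcomplex X [set` U])).
  have [Y XY Yn1] := cylinder_realizes_link UX Un AX.
  exists Y; split; first exact: nO.
  apply/nbhs_cylinderP; exists n.+1 => Z YZ [_ _]; apply; exists n.+1.
  by apply: (realizes_link_cylinder YZ) Yn1 => // v /Un/leqW.
exists X; split=> //; apply/nbhs_cylinderP; exists n => Z XZ [UZ AZ _].
apply: noproblem; rewrite (induced_subcomplex_cylinder XZ)//; split=> // v vU.
by rewrite (vertices_cylinder XZ (Un v vU)); exact: UZ.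
Qed.

Lemma is_rado_rado_class X : is_rado (simplexes X) -> rado_class R X.
Proof.
move=> radoX; exists nat, (simplexes X).
by split; [exact: rado_the_rado|exact: rado_isomorphic].
Qed.

End extension_problems.

Theorem theorem11p1 (R : realType) :
  residual (rado_class R) /\ dense (rado_class R).
Proof.
have res : residual (rado_class R).
  apply: (countable_cover_residual (I := ({fset nat} * {fset {fset nat}})%type)
    (F := fun UA => unsolved UA.1 UA.2)) => [[U A]|X nX].
    exact: unsolved_nowhere_dense.
  have [/is_rado_rado_class//|U [A UA]] := @not_rado_unsolved R X.
  by exists (U, A).
by split=> //; exact: residual_dense.
Qed.
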